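(* Let $\vec{v}\in\mathbb{R}^3$ be a unit vector, $\lambda\in\mathbb{R}$, and let $f:I\to\mathbb{R}$ and $g:J\to\mathbb{R}$ be smooth functions on open intervals $I,J\subset\mathbb{R}$. If the surface $z=f(x)+g(y)$, $(x,y)\in I\times J$, is a $\lambda$-translator with speed $\vec{v}$, then it is a cylindrical surface.
   Context: Let $\vec{v}\in\mathbb{R}^3$ with $|\vec{v}|=1$ and $\lambda\in\mathbb{R}$. An oriented surface $\Sigma$ immersed in Euclidean space $\mathbb{R}^3$, with unit normal $N$ and Gauss curvature $K$, is a $\lambda$-translator with speed $\vec{v}$ if $K=\langle N,\vec{v}\rangle+\lambda$ at every point of $\Sigma$. Here $(x,y,z)$ are the Cartesian coordinates of $\mathbb{R}^3$ and no relation between the coordinate axes and $\vec{v}$ is assumed. A cylindrical surface is a ruled surface whose rulings are all parallel, i.e. of the form $\{\gamma(s)+t\vec{w}\}$ with $\vec{w}$ a fixed nonzero vector and $\gamma$ a curve; a graph over $I\times J$ is regarded as cylindrical if it is an open part of such a surface (planes included). *)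

(* Defs.v *)
From Stdlib Require Import Reals.
From Coquelicot Require Import Coquelicot.
Open Scope R_scope.

Definition vec3 : Type := (R * R * R)%type.

Definition crd1 (p : vec3) : R := fst (fst p).
Definition crd2 (p : vec3) : R := snd (fst p).
Definition crd3 (p : vec3) : R := snd p.

Definition dot (p q : vec3) : R :=
  crd1 p * crd1 q + crd2 p * crd2 q + crd3 p * crd3 q.

(* Coquelicot's [norm] on products is a different norm. *)
Definition euclidean_norm (p : vec3) : R := sqrt (dot p p).

Definition cross (p q : vec3) : vec3 :=
  (crd2 p * crd3 q - crd3 p * crd2 q,
   crd3 p * crd1 q - crd1 p * crd3 q,
   crd1 p * crd2 q - crd2 p * crd1 q).

Definition Rbar_interval (a b : Rbar) (x : R) : Prop :=
  Rbar_lt a x /\ Rbar_lt x b.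

Definition smooth_on (I : R -> Prop) (f : R -> R) : Prop :=
  forall (n : nat) (x : R), I x -> ex_derive_n f n x.

Definition smooth_curve_on (I : R -> Prop) (gamma : R -> vec3) : Prop :=
  smooth_on I (fun s => crd1 (gamma s)) /\
  smooth_on I (fun s => crd2 (gamma s)) /\
  smooth_on I (fun s => crd3 (gamma s)).

Definition curve_derive (gamma : R -> vec3) (s : R) : vec3 :=
  (Derive (fun r => crd1 (gamma r)) s,
   Derive (fun r => crd2 (gamma r)) s,
   Derive (fun r => crd3 (gamma r)) s).

(* A parametrized surface is a map [X : R -> R -> vec3] considered on an open
   parameter domain [D]; only the values of [X] on [D] matter. *)

Definition partial_u (X : R -> R -> vec3) (u v : R) : vec3 :=
  curve_derive (fun r => X r v) u.

Definition partial_v (X : R -> R -> vec3) (u v : R) : vec3 :=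
  curve_derive (fun r => X u r) v.

(* The differential of [X] is injective at each point of [D]; the smoothness of
   [X] is not part of this predicate. *)
Definition immersive (D : R -> R -> Prop) (X : R -> R -> vec3) : Prop :=
  forall u v, D u v -> cross (partial_u X u v) (partial_v X u v) <> (0, 0, 0).

(* An orientation of the surface is a continuous choice of unit normal. *)
Definition unit_normal_field (D : R -> R -> Prop) (X N : R -> R -> vec3) : Prop :=
  forall u v, D u v ->
    euclidean_norm (N u v) = 1 /\
    dot (N u v) (partial_u X u v) = 0 /\
    dot (N u v) (partial_v X u v) = 0 /\
    continuous (fun p : R * R => N (fst p) (snd p)) (u, v).

(* Determinant of the second fundamental form (with respect to [N]) over the
   determinant of the first one. *)
Definition gauss_curvature (X N : R -> R -> vec3) (u v : R) : R :=
  let Xu := partial_u X u v in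
  let Xv := partial_v X u v in
  let L := dot (partial_u (partial_u X) u v) (N u v) in
  let M := dot (partial_v (partial_u X) u v) (N u v) in
  let P := dot (partial_v (partial_v X) u v) (N u v) in
  (L * P - M ^ 2) / (dot Xu Xu * dot Xv Xv - dot Xu Xv ^ 2).

(* The surface is a lambda-translator for one of its orientations. *)
Definition lambda_translator (vel : vec3) (lambda : R)
    (D : R -> R -> Prop) (X : R -> R -> vec3) : Prop :=
  immersive D X /\
  exists N : R -> R -> vec3,
    unit_normal_field D X N /\
    forall u v, D u v -> gauss_curvature X N u v = dot (N u v) vel + lambda.

Definition surface_image (D : R -> R -> Prop) (X : R -> R -> vec3)
    (q : vec3) : Prop :=
  exists u v, D u v /\ q = X u v.

Definition ruled_parallel (gamma : R -> vec3) (w : vec3) (s t : R) : vec3 :=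
  plus (gamma s) (scal t w).

(* [S] is an open part (in the subspace topology) of an immersed surface
   { gamma(s) + t w }. Without smoothness of [gamma] the set { gamma(s) + t w }
   could be all of R^3; immersivity says that gamma' is never parallel to w. *)
Definition cylindrical (S : vec3 -> Prop) : Prop :=
  exists (a b : Rbar) (gamma : R -> vec3) (w : vec3) (U : vec3 -> Prop),
    Rbar_lt a b /\
    smooth_curve_on (Rbar_interval a b) gamma /\
    w <> (0, 0, 0) /\
    immersive (fun s _ => Rbar_interval a b s) (ruled_parallel gamma w) /\
    open U /\
    forall q : vec3,
      S q <->
      U q /\ surface_image (fun s _ => Rbar_interval a b s)
                           (ruled_parallel gamma w) q.

Definition translation_graph (f g : R -> R) (x y : R) : vec3 :=
  (x, y, f x + g y).

Definition rectangle (I J : R -> Prop) (x y : R) : Prop := I x /\ J y.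

(* Main.v *)
Require Import Defs.
From Stdlib Require Import Reals Ranalysis5 Lra Classical.
From Coquelicot Require Import Coquelicot.
Open Scope R_scope.

(** Put p = f'(x), q = g'(y) and w = sqrt (1 + p^2 + q^2).  The graph has Gauss
    curvature f'' g'' / w^4 and unit normal s (-p, -q, 1) / w for a sign s that is
    constant because the rectangle is connected, so the translator equation reads
      f''(x) g''(y) = H (p, q),
      H (p, q) = lambda w^4 + w^3 (ga - al p - be q),   (al, be, ga) = s vel
    ([translator_equation]).

    If f' is constant, then f is affine and the graph is ruled by parallels to
    (1, 0, f'); likewise for g' ([cylindrical_of_affine_l], [cylindrical_of_affine_r]).
    Otherwise, by the intermediate value theorem, f' and g' both take all values of
    some open interval, and the product form of the left-hand side makes H a function
    of rank one on an open rectangle of the (p, q)-plane: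
      H (p1, q1) H (p2, q2) = H (p1, q2) H (p2, q1).
    It remains to see that this is impossible ([hess_not_rank_one]).

    A function of rank one satisfies H H_pq = H_p H_q ([rank_one_mixed_derivative]).
    Here H H_pq - H_p H_q = - w^2 (A + w B) with A and B polynomials in p and q
    ([hess_mixed_derivative_identity]), so A + w B = 0 on the rectangle.  Multiplying
    by A - w B removes the square root: the polynomial A^2 - w^2 B^2 vanishes on an
    open rectangle, hence on the whole plane ([norm_form_zero_everywhere]).  Its
    values at six points with coordinates in {-1, 0, 1} already contradict
    al^2 + be^2 + ga^2 = 1 ([norm_form_not_identically_zero]). *)

(** * Polynomial functions *)

(** The divided difference at every base point [c] drops the size by one.
    Quantifying over all [c] lets the argument on zeros divide by [x - c] at a point
    of its choice. *)
Fixpoint poly_size_le (n : nat) (F : R -> R) : Prop :=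
  match n with
  | O => forall x, F x = 0
  | S m => forall c, exists G,
      poly_size_le m G /\ forall x, F x = F c + (x - c) * G x
  end.

Definition polynomial (F : R -> R) : Prop := exists n, poly_size_le n F.

Lemma poly_size_le_zero n (F : R -> R) :
  (forall x, F x = 0) -> poly_size_le n F.
Proof.
revert F; induction n as [|n IH]; intros F HF; simpl; auto.
intros c; exists (fun _ => 0); split; [now apply IH|].
intros x; rewrite !HF; ring.
Qed.

Lemma poly_size_le_S n F : poly_size_le n F -> poly_size_le (S n) F.
Proof.
revert F; induction n as [|n IH]; intros F HF.
- now apply poly_size_le_zero.
- intros c; destruct (HF c) as [G [HG E]]; exists G; auto.
Qed.

Lemma poly_size_le_add m n F : poly_size_le n F -> poly_size_le (m + n) F.
Proof.
intros HF; induction m as [|m IH]; [exact HF|].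
now apply (poly_size_le_S (m + n)).
Qed.

Lemma poly_size_le_plus n F G : poly_size_le n F -> poly_size_le n G ->
  poly_size_le n (fun x => F x + G x).
Proof.
revert F G; induction n as [|n IH]; intros F G HF HG.
- intros x; rewrite (HF x), (HG x); ring.
- intros c; destruct (HF c) as [F1 [HF1 EF]]; destruct (HG c) as [G1 [HG1 EG]].
  exists (fun x => F1 x + G1 x); split; [now apply IH|].
  intros x; rewrite (EF x), (EG x); ring.
Qed.

Lemma poly_size_le_scal n k F : poly_size_le n F ->
  poly_size_le n (fun x => k * F x).
Proof.
revert F; induction n as [|n IH]; intros F HF.
- intros x; rewrite (HF x); ring.
- intros c; destruct (HF c) as [F1 [HF1 EF]].
  exists (fun x => k * F1 x); split; [now apply IH|].
  intros x; rewrite (EF x); ring.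
Qed.

Lemma poly_size_le_opp n F : poly_size_le n F ->
  poly_size_le n (fun x => - F x).
Proof.
revert F; induction n as [|n IH]; intros F HF.
- intros x; rewrite (HF x); ring.
- intros c; destruct (HF c) as [F1 [HF1 EF]].
  exists (fun x => - F1 x); split; [now apply IH|].
  intros x; rewrite (EF x); ring.
Qed.

Lemma poly_size_le_mult n m F G : poly_size_le n F -> poly_size_le m G ->
  poly_size_le (n + m) (fun x => F x * G x).
Proof.
revert F; induction n as [|n IH]; intros F HF HG.
- apply poly_size_le_zero; intros x; rewrite (HF x); ring.
- destruct m as [|m].
  + apply poly_size_le_zero; intros x; rewrite (HG x); ring.
  + intros c; destruct (HF c) as [F1 [HF1 EF]]; destruct (HG c) as [G1 [HG1 EG]].
    exists (fun x => F1 x * G x + F c * G1 x); split.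
    * apply poly_size_le_plus; [now apply IH|].
      apply poly_size_le_add, poly_size_le_S, poly_size_le_scal, HG1.
    * intros x; rewrite (EF x), (EG x); ring.
Qed.

Lemma polynomial_const k : polynomial (fun _ => k).
Proof.
exists 1%nat; intros c; exists (fun _ => 0); split; [now intros x|intros x; ring].
Qed.

Lemma polynomial_id : polynomial (fun x => x).
Proof.
exists 2%nat; intros c; exists (fun _ => 1); split; [|intros x; ring].
intros e; exists (fun _ => 0); split; [now intros x|intros x; ring].
Qed.

Lemma polynomial_plus F G : polynomial F -> polynomial G ->
  polynomial (fun x => F x + G x).
Proof.
intros [n HF] [m HG]; exists (m + n)%nat; apply poly_size_le_plus.
- now apply poly_size_le_add.
- rewrite Nat.add_comm; now apply poly_size_le_add.
Qed.

Lemma polynomial_mult F G : polynomial F -> polynomial G ->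
  polynomial (fun x => F x * G x).
Proof.
intros [n HF] [m HG]; exists (n + m)%nat; now apply poly_size_le_mult.
Qed.

Lemma polynomial_minus F G : polynomial F -> polynomial G ->
  polynomial (fun x => F x - G x).
Proof.
intros HF [n HG]; apply (polynomial_plus F (fun x => - G x)); [exact HF|].
exists n; now apply poly_size_le_opp.
Qed.

(** A zero [c] at the midpoint splits off a factor [x - c]; the cofactor, of smaller
    size, vanishes on the half interval to the right of [c], where [x - c] does not
    vanish. *)
Lemma polynomial_zero_of_interval F u v : polynomial F -> u < v ->
  (forall x, u < x < v -> F x = 0) -> forall x, F x = 0.
Proof.
intros [n HF]; revert F HF u v; induction n as [|n IH]; intros F HF u v Huv H0.
- exact HF.
- set (c := (u + v) / 2).
  destruct (HF c) as [G [HG E]].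
  assert (Fc : F c = 0) by (apply H0; unfold c; lra).
  assert (G0 : forall x, G x = 0).
  { apply (IH G HG c v); [unfold c; lra|].
    intros x Hx; assert (Fx : F x = 0) by (apply H0; unfold c in Hx; lra).
    rewrite E, Fc in Fx; apply (Rmult_eq_reg_l (x - c)); lra. }
  intros x; rewrite E, Fc, G0; ring.
Qed.

(** * Intervals *)

Lemma Rbar_interval_convex a b x1 x2 x : Rbar_interval a b x1 ->
  Rbar_interval a b x2 -> x1 <= x <= x2 -> Rbar_interval a b x.
Proof.
intros [H1 _] [_ H2] Hx; split.
- apply Rbar_lt_le_trans with x1; [exact H1|simpl; lra].
- apply Rbar_le_lt_trans with x2; [simpl; lra|exact H2].
Qed.

Lemma Rbar_interval_inhabited a b : Rbar_lt a b -> exists x, Rbar_interval a b x.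
Proof.
unfold Rbar_interval; destruct a as [a| |], b as [b| |]; simpl; intros H; try tauto.
- exists ((a + b) / 2); lra.
- exists (a + 1); lra.
- exists (b - 1); lra.
- exists 0; tauto.
Qed.

Lemma open_Rbar_interval a b : open (Rbar_interval a b).
Proof. apply open_and; [apply open_Rbar_gt|apply open_Rbar_lt]. Qed.

(** The intermediate value theorem, whatever the order of [x1] and [x2]. *)
Lemma interval_ivt a b h x1 x2 k :
  (forall x, Rbar_interval a b x -> continuity_pt h x) ->
  Rbar_interval a b x1 -> Rbar_interval a b x2 -> h x1 < k < h x2 ->
  exists x, Rbar_interval a b x /\ h x = k.
Proof.
intros Hc I1 I2 Hk.
destruct (Rtotal_order x1 x2) as [L|[E|L]].
- destruct (IVT_interv (fun x => h x - k) x1 x2) as [z [Hz Ez]]; try lra.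
  + intros x Hx; apply continuity_pt_minus; [|now apply continuity_pt_const; intros ? ?].
    apply Hc; now apply Rbar_interval_convex with x1 x2.
  + exists z; split; [now apply Rbar_interval_convex with x1 x2|lra].
- subst; lra.
- destruct (IVT_interv (fun x => k - h x) x2 x1) as [z [Hz Ez]]; try lra.
  + intros x Hx; apply continuity_pt_minus; [now apply continuity_pt_const; intros ? ?|].
    apply Hc; now apply Rbar_interval_convex with x2 x1.
  + exists z; split; [now apply Rbar_interval_convex with x2 x1|lra].
Qed.

Lemma interval_constant_sign a b h x1 x2 :
  (forall x, Rbar_interval a b x -> continuity_pt h x) ->
  (forall x, Rbar_interval a b x -> h x <> 0) ->
  Rbar_interval a b x1 -> Rbar_interval a b x2 -> 0 < h x1 -> 0 < h x2.
Proof.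
intros Hc Hn I1 I2 H1.
destruct (Rtotal_order (h x2) 0) as [L|[E|L]]; [|now destruct (Hn x2)|exact L].
destruct (interval_ivt a b h x2 x1 0) as [z [Iz Ez]]; try tauto.
now destruct (Hn z).
Qed.

Lemma affine_of_constant_derivative (a b : Rbar) (f : R -> R) (m : R) :
  Rbar_lt a b -> (forall x, Rbar_interval a b x -> is_derive f x m) ->
  exists n, forall x, Rbar_interval a b x -> f x = m * x + n.
Proof.
intros Hab Hf; destruct (Rbar_interval_inhabited a b Hab) as [x0 I0].
exists (f x0 - m * x0).
assert (Hseg : forall x y, Rbar_interval a b x -> Rbar_interval a b y -> x < y ->
  f x - m * x = f y - m * y).
{ intros x y Ix Iy L.
  apply (eq_is_derive (fun t => f t - m * t) x y); [|exact L].
  intros t Ht; change (is_derive (fun t => f t - m * t) t 0); rewrite <- (Rminus_diag m).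
  apply (is_derive_minus f (fun t => m * t) t m m).
  - apply Hf; now apply Rbar_interval_convex with x y.
  - auto_derive; [exact I|ring]. }
intros x Ix; destruct (Rtotal_order x x0) as [L|[E|L]].
- specialize (Hseg x x0 Ix I0 L); lra.
- subst; ring.
- specialize (Hseg x0 x I0 Ix L); lra.
Qed.

(** * The curvature equation as a function of the two slopes *)

(** The squared length of the upward normal (-p, -q, 1). *)
Definition wsq (p q : R) : R := 1 + p * p + q * q.

(** The inner product of (al, be, ga) with the upward normal (-p, -q, 1). *)
Definition lin (al be ga p q : R) : R := ga - al * p - be * q.

(** The value that the translator equation prescribes for the Hessian determinant
    f''(x) g''(y) at slopes [p] and [q]; [hess_p], [hess_q] and [hess_pq] are its
    partial derivatives, simplified by means of [wsq = sqrt wsq * sqrt wsq]. *)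
Definition hess (lambda al be ga p q : R) : R :=
  lambda * wsq p q * wsq p q + wsq p q * sqrt (wsq p q) * lin al be ga p q.

Definition hess_p (lambda al be ga p q : R) : R :=
  4 * lambda * p * wsq p q + 3 * p * sqrt (wsq p q) * lin al be ga p q
  - al * wsq p q * sqrt (wsq p q).

Definition hess_q (lambda al be ga p q : R) : R :=
  4 * lambda * q * wsq p q + 3 * q * sqrt (wsq p q) * lin al be ga p q
  - be * wsq p q * sqrt (wsq p q).

Definition hess_pq (lambda al be ga p q : R) : R :=
  8 * lambda * p * q + 3 * p * q * lin al be ga p q / sqrt (wsq p q)
  - 3 * be * p * sqrt (wsq p q) - 3 * al * q * sqrt (wsq p q).

Lemma wsq_pos p q : 0 < wsq p q.
Proof. unfold wsq; nra. Qed.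

Lemma wsq_sqrt p q : wsq p q = sqrt (wsq p q) * sqrt (wsq p q).
Proof. rewrite sqrt_sqrt; [reflexivity|]; apply Rlt_le, wsq_pos. Qed.

Lemma wsq_sqrt_pos p q : 0 < sqrt (wsq p q).
Proof. apply sqrt_lt_R0, wsq_pos. Qed.

Lemma is_derive_hess_p lambda al be ga p q :
  is_derive (fun t => hess lambda al be ga t q) p (hess_p lambda al be ga p q).
Proof.
pose proof (wsq_pos p q) as Hpos; pose proof (wsq_sqrt_pos p q) as Hs.
pose proof (wsq_sqrt p q) as E.
unfold hess, hess_p, lin; unfold wsq in *; auto_derive; [auto|].
set (w := sqrt (1 + p * p + q * q)) in *.
replace (1 + p * p + q * q) with (w * w) by lra.
field; lra.
Qed.

Lemma is_derive_hess_q lambda al be ga p q :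
  is_derive (fun t => hess lambda al be ga p t) q (hess_q lambda al be ga p q).
Proof.
pose proof (wsq_pos p q) as Hpos; pose proof (wsq_sqrt_pos p q) as Hs.
pose proof (wsq_sqrt p q) as E.
unfold hess, hess_q, lin; unfold wsq in *; auto_derive; [auto|].
set (w := sqrt (1 + p * p + q * q)) in *.
replace (1 + p * p + q * q) with (w * w) by lra.
field; lra.
Qed.

Lemma is_derive_hess_pq lambda al be ga p q :
  is_derive (fun t => hess_p lambda al be ga p t) q (hess_pq lambda al be ga p q).
Proof.
pose proof (wsq_pos p q) as Hpos; pose proof (wsq_sqrt_pos p q) as Hs.
pose proof (wsq_sqrt p q) as E.
unfold hess_p, hess_pq, lin; unfold wsq in *; auto_derive; [auto|].
set (w := sqrt (1 + p * p + q * q)) in *.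
replace (1 + p * p + q * q) with (w * w) by lra.
field; lra.
Qed.

Lemma is_derive_locally_zero (h : R -> R) x l :
  locally x (fun t => h t = 0) -> is_derive h x l -> l = 0.
Proof.
intros Hz Hd; rewrite <- (is_derive_unique h x l Hd).
rewrite (Derive_ext_loc h (fun _ => 0) x Hz); apply Derive_const.
Qed.

(** Differentiate [H t q' * H p q = H t q * H p q'] in [t] at [p], then the result in
    [q'] at [q].  Unlike the derivation through the logarithm of [H], this allows
    zeros of [H]. *)
Lemma rank_one_mixed_derivative (P Q : R -> Prop) (H Hp Hq Hpq : R -> R -> R) :
  open P -> open Q ->
  (forall p q, is_derive (fun t => H t q) p (Hp p q)) ->
  (forall p q, is_derive (fun t => H p t) q (Hq p q)) ->
  (forall p q, is_derive (fun t => Hp p t) q (Hpq p q)) ->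
  (forall p1 p2 q1 q2, P p1 -> P p2 -> Q q1 -> Q q2 ->
     H p1 q1 * H p2 q2 = H p1 q2 * H p2 q1) ->
  forall p q, P p -> Q q -> H p q * Hpq p q = Hp p q * Hq p q.
Proof.
intros OP OQ Dp Dq Dpq Hr p q Pp Qq.
assert (Step : forall q', Q q' -> Hp p q' * H p q - Hp p q * H p q' = 0).
{ intros q' Qq'.
  apply (is_derive_locally_zero (fun t => H t q' * H p q - H t q * H p q') p).
  - apply (filter_imp P); [|now apply OP].
    intros t Pt; rewrite (Hr t p q' q); auto; ring.
  - apply (is_derive_minus (fun t => H t q' * H p q) (fun t => H t q * H p q')).
    + apply (is_derive_scal_l (fun t => H t q') p (Hp p q') (H p q)), Dp.
    + apply (is_derive_scal_l (fun t => H t q) p (Hp p q) (H p q')), Dp. }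
enough (E : Hpq p q * H p q - Hp p q * Hq p q = 0) by lra.
apply (is_derive_locally_zero (fun t => Hp p t * H p q - Hp p q * H p t) q).
- apply (filter_imp Q); [|now apply OQ]; exact Step.
- apply (is_derive_minus (fun t => Hp p t * H p q) (fun t => Hp p q * H p t)).
  + apply (is_derive_scal_l (fun t => Hp p t) q (Hpq p q) (H p q)), Dpq.
  + apply (is_derive_scal (fun t => H p t) q (Hp p q)), Dq.
Qed.

(** [even_part] and [odd_part] are the polynomials A and B for which A + w B is
    proportional to the rank-one defect of [hess]: the parts of it that are even and
    odd in the square root w of [wsq]. *)
Definition even_part (lambda al be ga p q : R) : R :=
  8 * (lambda * lambda) * p * q * wsq p q
  + 6 * p * q * (lin al be ga p q * lin al be ga p q)
  + al * be * (wsq p q * wsq p q).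

Definition odd_part (lambda al be ga p q : R) : R :=
  lambda * (13 * p * q * lin al be ga p q - wsq p q * (be * p + al * q)).

Lemma hess_mixed_derivative_identity lambda al be ga p q :
  hess lambda al be ga p q * hess_pq lambda al be ga p q
  - hess_p lambda al be ga p q * hess_q lambda al be ga p q
  = - wsq p q * (even_part lambda al be ga p q
                 + sqrt (wsq p q) * odd_part lambda al be ga p q).
Proof.
pose proof (wsq_sqrt_pos p q) as Hs; pose proof (wsq_sqrt p q) as E.
unfold hess, hess_p, hess_q, hess_pq, even_part, odd_part.
set (w := sqrt (wsq p q)) in *; rewrite E.
field; lra.
Qed.

(** The norm A^2 - w^2 B^2 of A + w B over the field of rational functions, which is
    free of square roots. *)
Definition norm_form (lambda al be ga p q : R) : R :=
  even_part lambda al be ga p q * even_part lambda al be ga p q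
  - wsq p q * (odd_part lambda al be ga p q * odd_part lambda al be ga p q).

Lemma norm_form_zero lambda al be ga p q :
  hess lambda al be ga p q * hess_pq lambda al be ga p q
    = hess_p lambda al be ga p q * hess_q lambda al be ga p q ->
  norm_form lambda al be ga p q = 0.
Proof.
intros H; pose proof (hess_mixed_derivative_identity lambda al be ga p q) as E.
pose proof (wsq_pos p q); pose proof (wsq_sqrt p q) as W.
unfold norm_form.
set (A := even_part _ _ _ _ _ _) in *; set (B := odd_part _ _ _ _ _ _) in *.
assert (Z : A + sqrt (wsq p q) * B = 0).
{ apply (Rmult_eq_reg_l (- wsq p q)); lra. }
rewrite W at 1.
replace (_ - _) with ((A + sqrt (wsq p q) * B) * (A - sqrt (wsq p q) * B)) by ring.
rewrite Z; ring.
Qed.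

Ltac polynomiality :=
  repeat first
    [ apply polynomial_const | apply polynomial_id
    | apply polynomial_minus | apply polynomial_plus | apply polynomial_mult ].

(** In each variable separately the norm is a polynomial; the zeros are extended
    in [p] for each [q] of the rectangle, and then in [q] for each real [p]. *)
Lemma norm_form_zero_everywhere lambda al be ga u1 v1 u2 v2 :
  u1 < v1 -> u2 < v2 ->
  (forall p q, u1 < p < v1 -> u2 < q < v2 -> norm_form lambda al be ga p q = 0) ->
  forall p q, norm_form lambda al be ga p q = 0.
Proof.
intros L1 L2 Hz p q.
apply (polynomial_zero_of_interval (fun t => norm_form lambda al be ga p t) u2 v2);
  [unfold norm_form, even_part, odd_part, lin, wsq; polynomiality|exact L2|].
intros q' Hq'.
apply (polynomial_zero_of_interval (fun t => norm_form lambda al be ga t q') u1 v1);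
  [unfold norm_form, even_part, odd_part, lin, wsq; polynomiality|exact L1|].
intros p' Hp'; now apply Hz.
Qed.

(** On the coordinate axes the norm gives [al * be = lambda * al = lambda * be = 0].
    If [lambda = 0], then off the axes the linear form [lin] vanishes, which makes
    (al, be, ga) zero.  If [lambda <> 0], then al = be = 0 and ga^2 = 1, and the
    norm at (1, 1) is a quadratic polynomial in [lambda^2] without real roots. *)
Lemma norm_form_not_identically_zero lambda al be ga :
  al * al + be * be + ga * ga = 1 ->
  ~ (forall p q, norm_form lambda al be ga p q = 0).
Proof.
intros Hu Hz.
pose proof (Hz 0 0) as H00; pose proof (Hz 0 1) as H01; pose proof (Hz 1 0) as H10.
pose proof (Hz 1 1) as H11; pose proof (Hz 1 (-1)) as H1m; pose proof (Hz (-1) 1) as Hm1.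
unfold norm_form, even_part, odd_part, lin, wsq in *; clear Hz.
assert (Hab : al * be = 0) by (apply Rsqr_0_uniq; unfold Rsqr; lra).
assert (Ha : lambda * al = 0).
{ apply Rsqr_0_uniq; unfold Rsqr.
  replace (al * be) with 0 in H01 by auto. lra. }
assert (Hb : lambda * be = 0).
{ apply Rsqr_0_uniq; unfold Rsqr.
  replace (al * be) with 0 in H10 by auto. lra. }
destruct (Req_dec lambda 0) as [->|Hl].
- rewrite Hab in H11, H1m, Hm1.
  assert (E1 : ga - al - be = 0) by (apply Rsqr_0_uniq, Rsqr_0_uniq; unfold Rsqr; lra).
  assert (E2 : ga - al + be = 0) by (apply Rsqr_0_uniq, Rsqr_0_uniq; unfold Rsqr; lra).
  assert (E3 : ga + al - be = 0) by (apply Rsqr_0_uniq, Rsqr_0_uniq; unfold Rsqr; lra).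
  assert (al = 0) by lra; assert (be = 0) by lra; assert (ga = 0) by lra; subst; lra.
- assert (al = 0) by (apply Rmult_integral in Ha; tauto).
  assert (be = 0) by (apply Rmult_integral in Hb; tauto).
  subst al be.
  assert (Hg : ga * ga = 1) by lra.
  assert (E : (24 * (lambda * lambda) + 6) * (24 * (lambda * lambda) + 6)
              - 3 * 169 * (lambda * lambda) = 0).
  { rewrite <- H11.
    transitivity ((24 * (lambda * lambda) + 6 * (ga * ga))
                  * (24 * (lambda * lambda) + 6 * (ga * ga))
                  - 3 * 169 * (lambda * lambda) * (ga * ga)); [rewrite Hg|]; ring. }
  (* With L = lambda^2, E reads 576 L^2 - 219 L + 36 = 0; complete the square. *)
  pose proof (Rle_0_sqr (24 * (lambda * lambda) - 219 / 48)) as Hsq.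
  unfold Rsqr in Hsq; lra.
Qed.

Lemma hess_not_rank_one lambda al be ga u1 v1 u2 v2 :
  al * al + be * be + ga * ga = 1 -> u1 < v1 -> u2 < v2 ->
  ~ (forall p1 p2 q1 q2,
       u1 < p1 < v1 -> u1 < p2 < v1 -> u2 < q1 < v2 -> u2 < q2 < v2 ->
       hess lambda al be ga p1 q1 * hess lambda al be ga p2 q2
       = hess lambda al be ga p1 q2 * hess lambda al be ga p2 q1).
Proof.
intros Hu L1 L2 Hr.
apply (norm_form_not_identically_zero lambda al be ga Hu).
apply (norm_form_zero_everywhere lambda al be ga u1 v1 u2 v2 L1 L2).
intros p q Hp Hq; apply norm_form_zero.
apply (rank_one_mixed_derivative (fun t => u1 < t < v1) (fun t => u2 < t < v2)
  _ (hess_p lambda al be ga) (hess_q lambda al be ga)); auto.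
- apply open_and; [apply open_gt|apply open_lt].
- apply open_and; [apply open_gt|apply open_lt].
- intros; apply is_derive_hess_p.
- intros; apply is_derive_hess_q.
- intros; apply is_derive_hess_pq.
Qed.

(** * Geometry of a translation graph *)

(** This holds without differentiability, since the difference quotients agree. *)
Lemma Derive_plus_const (f : R -> R) k x : Derive (fun r => f r + k) x = Derive f x.
Proof.
unfold Derive; f_equal; apply Lim_ext; intros y; f_equal; ring.
Qed.

Lemma partial_u_translation_graph f g u v :
  partial_u (translation_graph f g) u v = (1, 0, Derive f u).
Proof.
unfold partial_u, curve_derive, translation_graph, crd1, crd2, crd3; cbn [fst snd].
now rewrite Derive_id, Derive_const, Derive_plus_const.
Qed.

Lemma partial_v_translation_graph f g u v :
  partial_v (translation_graph f g) u v = (0, 1, Derive g v).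
Proof.
unfold partial_v, curve_derive, translation_graph, crd1, crd2, crd3; cbn [fst snd].
rewrite Derive_id, Derive_const; f_equal.
rewrite (Derive_ext _ (fun r => g r + f u)); [apply Derive_plus_const|intros; ring].
Qed.

Lemma curve_derive_ext gamma delta s : (forall r, gamma r = delta r) ->
  curve_derive gamma s = curve_derive delta s.
Proof.
intros E; unfold curve_derive; f_equal; [f_equal|]; apply Derive_ext;
  intros r; now rewrite E.
Qed.

Lemma partial_uu_translation_graph f g u v :
  partial_u (partial_u (translation_graph f g)) u v = (0, 0, Derive (Derive f) u).
Proof.
unfold partial_u at 1.
rewrite (curve_derive_ext _ (fun r => (1, 0, Derive f r)));
  [|intros r; apply partial_u_translation_graph].
unfold curve_derive, crd1, crd2, crd3; cbn [fst snd].
now rewrite !Derive_const.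
Qed.

Lemma partial_uv_translation_graph f g u v :
  partial_v (partial_u (translation_graph f g)) u v = (0, 0, 0).
Proof.
unfold partial_v.
rewrite (curve_derive_ext _ (fun r => (1, 0, Derive f u)));
  [|intros r; apply partial_u_translation_graph].
unfold curve_derive, crd1, crd2, crd3; cbn [fst snd].
now rewrite !Derive_const.
Qed.

Lemma partial_vv_translation_graph f g u v :
  partial_v (partial_v (translation_graph f g)) u v = (0, 0, Derive (Derive g) v).
Proof.
unfold partial_v at 1.
rewrite (curve_derive_ext _ (fun r => (0, 1, Derive g r)));
  [|intros r; apply partial_v_translation_graph].
unfold curve_derive, crd1, crd2, crd3; cbn [fst snd].
now rewrite !Derive_const.
Qed.

(** The sign is propagated along a horizontal and then a vertical segment. *)
Lemma rectangle_constant_sign (a b c d : Rbar) (h : R -> R -> R) :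
  Rbar_lt a b -> Rbar_lt c d ->
  (forall x y, rectangle (Rbar_interval a b) (Rbar_interval c d) x y ->
     h x y <> 0 /\ continuous (fun p : R * R => h (fst p) (snd p)) (x, y)) ->
  exists s, s * s = 1 /\
    forall x y, rectangle (Rbar_interval a b) (Rbar_interval c d) x y -> 0 < s * h x y.
Proof.
intros Hab Hcd Hh.
assert (Hprop : forall s x1 x2 y1 y2, s * s = 1 -> Rbar_interval a b x1 ->
  Rbar_interval a b x2 -> Rbar_interval c d y1 -> Rbar_interval c d y2 ->
  0 < s * h x1 y1 -> 0 < s * h x2 y2).
{ intros s x1 x2 y1 y2 Hs I1 I2 J1 J2 P1.
  assert (Hs0 : s <> 0) by (intros ->; lra).
  apply (interval_constant_sign c d (fun y => s * h x2 y) y1 y2); auto.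
  - intros y Jy; apply continuity_pt_mult; [now apply continuity_pt_const; intros ? ?|].
    apply continuity_pt_filterlim.
    apply (continuous_comp_2 (fun _ => x2) (fun t => t) h).
    + apply continuous_const.
    + apply continuous_id.
    + now apply (Hh x2 y).
  - intros y Jy; apply Rmult_integral_contrapositive_currified; [exact Hs0|].
    now apply (Hh x2 y).
  - apply (interval_constant_sign a b (fun x => s * h x y1) x1 x2); auto.
    + intros x Ix; apply continuity_pt_mult; [now apply continuity_pt_const; intros ? ?|].
      apply continuity_pt_filterlim.
      apply (continuous_comp_2 (fun t => t) (fun _ => y1) h).
      * apply continuous_id.
      * apply continuous_const.
      * now apply (Hh x y1).
    + intros x Ix; apply Rmult_integral_contrapositive_currified; [exact Hs0|].
      now apply (Hh x y1). }
destruct (Rbar_interval_inhabited a b Hab) as [x0 I0].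
destruct (Rbar_interval_inhabited c d Hcd) as [y0 J0].
destruct (Hh x0 y0 (conj I0 J0)) as [Hn _].
destruct (Rtotal_order (h x0 y0) 0) as [L|[E|L]]; [|tauto|].
- exists (-1); split; [ring|]; intros x y [Ix Jy].
  apply (Hprop (-1) x0 x y0 y); auto; lra.
- exists 1; split; [ring|]; intros x y [Ix Jy].
  apply (Hprop 1 x0 x y0 y); auto; lra.
Qed.

(** The sign [s] of the third component of the normal is absorbed into the velocity. *)
Lemma translator_equation (vel : vec3) (lambda : R) (a b c d : Rbar) (f g : R -> R) :
  Rbar_lt a b -> Rbar_lt c d ->
  lambda_translator vel lambda
    (rectangle (Rbar_interval a b) (Rbar_interval c d)) (translation_graph f g) ->
  exists s, s * s = 1 /\
    forall x y, rectangle (Rbar_interval a b) (Rbar_interval c d) x y ->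
      Derive (Derive f) x * Derive (Derive g) y
      = hess lambda (s * crd1 vel) (s * crd2 vel) (s * crd3 vel)
          (Derive f x) (Derive g y).
Proof.
intros Hab Hcd [_ [N [HN HK]]].
assert (Hframe : forall x y, rectangle (Rbar_interval a b) (Rbar_interval c d) x y ->
  crd1 (N x y) = - Derive f x * crd3 (N x y) /\
  crd2 (N x y) = - Derive g y * crd3 (N x y) /\
  wsq (Derive f x) (Derive g y) * (crd3 (N x y) * crd3 (N x y)) = 1).
{ intros x y Hxy; destruct (HN x y Hxy) as [H1 [Hu [Hv _]]].
  rewrite partial_u_translation_graph in Hu; rewrite partial_v_translation_graph in Hv.
  unfold euclidean_norm, dot in *.
  set (n1 := crd1 (N x y)) in *; set (n2 := crd2 (N x y)) in *;
    set (n3 := crd3 (N x y)) in *.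
  unfold crd1, crd2, crd3 in Hu, Hv; simpl in Hu, Hv.
  assert (E1 : n1 = - Derive f x * n3) by lra.
  assert (E2 : n2 = - Derive g y * n3) by lra.
  split; [exact E1|split; [exact E2|]].
  assert (Hsum : n1 * n1 + n2 * n2 + n3 * n3 = 1).
  { rewrite <- (sqrt_sqrt (n1 * n1 + n2 * n2 + n3 * n3)); [rewrite H1; ring|nra]. }
  rewrite <- Hsum, E1, E2; unfold wsq; ring. }
destruct (rectangle_constant_sign a b c d (fun x y => crd3 (N x y)) Hab Hcd)
  as [s [Hs Hpos]].
{ intros x y Hxy; split.
  - intros E; destruct (Hframe x y Hxy) as [_ [_ H]]; rewrite E in H; lra.
  - destruct (HN x y Hxy) as [_ [_ [_ Hc]]].
    apply (continuous_comp (fun p : R * R => N (fst p) (snd p)) (fun q : vec3 => snd q));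
      [exact Hc|apply continuous_snd]. }
exists s; split; [exact Hs|]; intros x y Hxy.
specialize (HK x y Hxy); specialize (Hpos x y Hxy).
destruct (Hframe x y Hxy) as [E1 [E2 E3]].
unfold gauss_curvature in HK.
rewrite partial_uu_translation_graph, partial_uv_translation_graph,
  partial_vv_translation_graph, partial_u_translation_graph,
  partial_v_translation_graph in HK.
unfold dot in HK; rewrite E1, E2 in HK.
pose proof (wsq_pos (Derive f x) (Derive g y)) as Wpos.
pose proof (wsq_sqrt_pos (Derive f x) (Derive g y)) as Rpos.
pose proof (wsq_sqrt (Derive f x) (Derive g y)) as W.
set (n := crd3 (N x y)) in *; set (p := Derive f x) in *; set (q := Derive g y) in *.
set (v1 := crd1 vel) in *; set (v2 := crd2 vel) in *; set (v3 := crd3 vel) in *.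
unfold crd1, crd2, crd3 in HK; simpl in HK.
set (F := Derive (Derive f) x) in *; set (G := Derive (Derive g) y) in *.
unfold hess, lin.
set (w := sqrt (wsq p q)) in *.
(* Both sides are positive and have the same square. *)
assert (En : s * n = / w).
{ apply Rmult_eq_reg_l with w; [|lra].
  rewrite Rinv_r; [|lra].
  apply Rsqr_inj; [apply Rmult_le_pos; lra|lra|unfold Rsqr].
  transitivity (s * s * (w * w * (n * n))); [ring|].
  rewrite <- W, E3, Hs; reflexivity. }
assert (En' : n = s * / w) by (rewrite <- En; transitivity (s * s * n); [rewrite Hs|]; ring).
(* The Gram determinant (1 + p^2) (1 + q^2) - (p q)^2 equals [wsq p q]. *)
replace (_ / _) with (F * G * (n * n) / wsq p q) in HK
  by (unfold wsq in *; field; repeat apply conj; nra).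
assert (Enn : n * n = / (w * w)).
{ rewrite En'; transitivity (s * s * / (w * w)); [field; lra|rewrite Hs; ring]. }
rewrite Enn, En', W in HK; rewrite W.
transitivity (w * w * w * w * (F * G * / (w * w) / (w * w))); [field; lra|].
rewrite HK; field; lra.
Qed.

Lemma derivative_constant_or_interval a b f : Rbar_lt a b ->
  smooth_on (Rbar_interval a b) f ->
  (exists m n, forall x, Rbar_interval a b x -> f x = m * x + n) \/
  (exists u v, u < v /\
     forall p, u < p < v -> exists x, Rbar_interval a b x /\ Derive f x = p).
Proof.
intros Hab Hf.
destruct (classic (exists x1 x2, Rbar_interval a b x1 /\ Rbar_interval a b x2 /\
  Derive f x1 < Derive f x2)) as [[x1 [x2 [I1 [I2 L]]]]|Hn].
- right; exists (Derive f x1), (Derive f x2); split; [exact L|].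
  intros p Hp; apply (interval_ivt a b _ x1 x2); auto.
  intros x Ix; apply continuity_pt_filterlim, (ex_derive_continuous (Derive f)).
  exact (Hf 2%nat x Ix).
- left; destruct (Rbar_interval_inhabited a b Hab) as [x0 I0].
  exists (Derive f x0); apply affine_of_constant_derivative; [exact Hab|].
  intros x Ix; replace (Derive f x0) with (Derive f x).
  + apply Derive_correct; exact (Hf 1%nat x Ix).
  + destruct (Rtotal_order (Derive f x) (Derive f x0)) as [L|[E|L]]; [|exact E|];
      exfalso; apply Hn; eauto.
Qed.

(** * Cylinders *)

Lemma smooth_on_id I : smooth_on I (fun s => s).
Proof.
intros n x _; apply (ex_derive_n_ext (fun s => s ^ 1)); [intros; ring|].
apply ex_derive_n_pow.
Qed.

Lemma smooth_on_const I k : smooth_on I (fun _ => k).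
Proof. intros n x _; apply ex_derive_n_const. Qed.

Lemma smooth_on_plus_const a b f k : smooth_on (Rbar_interval a b) f ->
  smooth_on (Rbar_interval a b) (fun s => f s + k).
Proof.
intros Hf n x Ix; apply ex_derive_n_plus.
- apply (filter_imp (Rbar_interval a b)); [|now apply open_Rbar_interval].
  intros y Iy j _; now apply Hf.
- apply filter_forall; intros y j _; apply ex_derive_n_const.
Qed.

Lemma ruled_parallel_coordinates gamma w s t :
  ruled_parallel gamma w s t
  = (crd1 (gamma s) + t * crd1 w, crd2 (gamma s) + t * crd2 w,
     crd3 (gamma s) + t * crd3 w).
Proof. reflexivity. Qed.

Lemma partial_u_ruled_parallel gamma w s t :
  partial_u (ruled_parallel gamma w) s t = curve_derive gamma s.
Proof.
unfold partial_u, curve_derive; f_equal; [f_equal|];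
  exact (Derive_plus_const _ _ _).
Qed.

Lemma partial_v_ruled_parallel gamma w s t :
  partial_v (ruled_parallel gamma w) s t = w.
Proof.
assert (E : forall k l, Derive (fun r => k + r * l) t = l).
{ intros k l; apply is_derive_unique; auto_derive; [exact I|ring]. }
rewrite (surjective_pairing w), (surjective_pairing (fst w)).
unfold partial_v, curve_derive; f_equal; [f_equal|]; exact (E _ _).
Qed.

Lemma open_crd1 (P : R -> Prop) : open P -> open (fun q : vec3 => P (crd1 q)).
Proof.
intros HP; apply (open_comp crd1 P); [|exact HP].
intros q _; apply (continuous_comp (fun q : vec3 => fst q) (fun r : R * R => fst r));
  apply continuous_fst.
Qed.

Lemma open_crd2 (P : R -> Prop) : open P -> open (fun q : vec3 => P (crd2 q)).
Proof.
intros HP; apply (open_comp crd2 P); [|exact HP].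
intros q _; apply (continuous_comp (fun q : vec3 => fst q) (fun r : R * R => snd r));
  [apply continuous_fst|apply continuous_snd].
Qed.

(** The rulings are parallel to (1, 0, m) over the profile curve z = g(y) + n in the
    plane x = 0.  They are full lines, so the open slab over the [x]-interval cuts the
    graph out of the cylinder. *)
Lemma cylindrical_of_affine_l (a b c d : Rbar) (f g : R -> R) (m n : R) :
  Rbar_lt c d -> smooth_on (Rbar_interval c d) g ->
  (forall x, Rbar_interval a b x -> f x = m * x + n) ->
  cylindrical
    (surface_image (rectangle (Rbar_interval a b) (Rbar_interval c d))
                   (translation_graph f g)).
Proof.
intros Hcd Hg Hf.
set (gamma := fun s : R => (0, s, g s + n)).
assert (Er : forall s t, ruled_parallel gamma (1, 0, m) s t = (t, s, m * t + n + g s)).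
{ intros s t; rewrite ruled_parallel_coordinates; unfold gamma, crd1, crd2, crd3;
  cbn [fst snd]; f_equal; [f_equal|]; ring. }
exists c, d, gamma, (1, 0, m), (fun q => Rbar_interval a b (crd1 q)).
split; [exact Hcd|]; split; [|split; [|split; [|split]]].
- split; [|split].
  + exact (smooth_on_const _ 0).
  + exact (smooth_on_id _).
  + exact (smooth_on_plus_const _ _ _ n Hg).
- intros E; injection E; lra.
- intros s t _; rewrite partial_u_ruled_parallel, partial_v_ruled_parallel.
  unfold cross, curve_derive, gamma, crd1, crd2, crd3; cbn [fst snd].
  rewrite Derive_const, Derive_id; intros E; injection E; lra.
- apply open_crd1, open_Rbar_interval.
- intros q; split.
  + intros [x [y [[Ix Jy] ->]]]; split; [exact Ix|].
    exists y, x; split; [exact Jy|].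
    now rewrite Er, <- (Hf x Ix).
  + intros [Iq [s [t [Js ->]]]]; rewrite Er in *.
    exists t, s; split; [now split|].
    now rewrite <- (Hf t Iq).
Qed.

Lemma cylindrical_of_affine_r (a b c d : Rbar) (f g : R -> R) (m n : R) :
  Rbar_lt a b -> smooth_on (Rbar_interval a b) f ->
  (forall y, Rbar_interval c d y -> g y = m * y + n) ->
  cylindrical
    (surface_image (rectangle (Rbar_interval a b) (Rbar_interval c d))
                   (translation_graph f g)).
Proof.
intros Hab Hf Hg.
set (gamma := fun s : R => (s, 0, f s + n)).
assert (Er : forall s t, ruled_parallel gamma (0, 1, m) s t = (s, t, f s + (m * t + n))).
{ intros s t; rewrite ruled_parallel_coordinates; unfold gamma, crd1, crd2, crd3;
  cbn [fst snd]; f_equal; [f_equal|]; ring. }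
exists a, b, gamma, (0, 1, m), (fun q => Rbar_interval c d (crd2 q)).
split; [exact Hab|]; split; [|split; [|split; [|split]]].
- split; [|split].
  + exact (smooth_on_id _).
  + exact (smooth_on_const _ 0).
  + exact (smooth_on_plus_const _ _ _ n Hf).
- intros E; injection E; lra.
- intros s t _; rewrite partial_u_ruled_parallel, partial_v_ruled_parallel.
  unfold cross, curve_derive, gamma, crd1, crd2, crd3; cbn [fst snd].
  rewrite Derive_const, Derive_id; intros E; injection E; lra.
- apply open_crd2, open_Rbar_interval.
- intros q; split.
  + intros [x [y [[Ix Jy] ->]]]; split; [exact Jy|].
    exists x, y; split; [exact Ix|].
    now rewrite Er, <- (Hg y Jy).
  + intros [Jq [s [t [Is ->]]]]; rewrite Er in *.
    exists s, t; split; [now split|].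
    now rewrite <- (Hg t Jq).
Qed.

Theorem theorem2p4 (vel : vec3) (lambda : R) (a b c d : Rbar) (f g : R -> R) :
  euclidean_norm vel = 1 ->
  Rbar_lt a b ->
  Rbar_lt c d ->
  smooth_on (Rbar_interval a b) f ->
  smooth_on (Rbar_interval c d) g ->
  lambda_translator vel lambda
    (rectangle (Rbar_interval a b) (Rbar_interval c d))
    (translation_graph f g) ->
  cylindrical
    (surface_image (rectangle (Rbar_interval a b) (Rbar_interval c d))
                   (translation_graph f g)).
Proof.
intros Hv Hab Hcd Hf Hg Htr.
destruct (derivative_constant_or_interval a b f Hab Hf)
  as [[m [n Hm]]|[u1 [v1 [L1 P1]]]];
  [now apply cylindrical_of_affine_l with m n|].
destruct (derivative_constant_or_interval c d g Hcd Hg)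
  as [[m [n Hm]]|[u2 [v2 [L2 P2]]]];
  [now apply cylindrical_of_affine_r with m n|].
exfalso.
destruct (translator_equation vel lambda a b c d f g Hab Hcd Htr) as [s [Hs Heq]].
apply (hess_not_rank_one lambda
  (s * crd1 vel) (s * crd2 vel) (s * crd3 vel) u1 v1 u2 v2); [|exact L1|exact L2|].
- assert (Hd : dot vel vel = 1).
  { unfold euclidean_norm in Hv; rewrite <- (sqrt_sqrt (dot vel vel)), Hv;
      [ring|unfold dot; nra]. }
  rewrite <- Hd; transitivity (s * s * dot vel vel); [unfold dot; ring|].
  rewrite Hs; ring.
- intros p1 p2 q1 q2 Hp1 Hp2 Hq1 Hq2.
  destruct (P1 p1 Hp1) as [x1 [I1 <-]]; destruct (P1 p2 Hp2) as [x2 [I2 <-]].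
  destruct (P2 q1 Hq1) as [y1 [J1 <-]]; destruct (P2 q2 Hq2) as [y2 [J2 <-]].
  rewrite <- !Heq by now split.
  ring.
Qed.
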